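(* Let $\mathcal{H}$ be a Hilbert space of finite dimension $d$ with fixed computational basis $\{|j\rangle\}_{j=1}^d$, and let $f_1=|f_1\rangle\langle f_1|$ with $|f_1\rangle=\frac{1}{\sqrt d}\sum_{j=1}^d|j\rangle$. Let $\alpha\in(0,1)$ and $z\geqslant\max\{\alpha,1-\alpha\}$. If a unitary operator $U$ on $\mathcal{H}$ satisfies $Uf_1U^\dagger=f_1$, then for every density matrix $\rho$ on $\mathcal{H}$, $$\mathcal{T}^{\mathrm{GR}}_{\alpha,z}(U\rho U^\dagger)=\mathcal{T}^{\mathrm{GR}}_{\alpha,z}(\rho).$$
   Context: A density matrix is a positive semidefinite operator of trace one. $\mathcal{T}^{\mathrm{GR}}_{\alpha,z}(\rho)=1-f_{\alpha,z}(f_1\|\rho)$, where $f_{\alpha,z}(\tau\|\sigma)=\operatorname{Tr}[(\tau^{\frac{\alpha}{2z}}\sigma^{\frac{1-\alpha}{z}}\tau^{\frac{\alpha}{2z}})^z]$ and powers of positive semidefinite operators are defined by functional calculus. *)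

(* Defs.v *)
From mathcomp Require Export all_boot all_order all_algebra.
From mathcomp Require Export complex.
From mathcomp Require Export reals exp.

Set Implicit Arguments.
Unset Strict Implicit.
Unset Printing Implicit Defensive.

Import Order.TTheory GRing.Theory Num.Theory.

Local Open Scope ring_scope.
Local Open Scope complex_scope.
Local Open Scope sesquilinear_scope.

(* Operators on the d-dimensional space R[i]^d are matrices in 'M[R[i]]_d acting
   on column vectors; M ^t* is the adjoint of M. *)

(* In R[i] the order 0 <= x also says that x is real. *)
Definition psdmx (R : realType) (n : nat) (A : 'M[R[i]]_n) : Prop :=
  A \is hermsymmx /\ forall v : 'cV[R[i]]_n, 0 <= (v ^t* *m A *m v) 0 0.

Definition density_matrix (R : realType) (n : nat) (rho : 'M[R[i]]_n) : Prop :=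
  psdmx rho /\ \tr rho = 1.

(* Functional calculus for Hermitian A = P^* D P, with P = spectralmx A unitary
   and D = diag_mx (spectral_diag A) real; it is only meant for Hermitian A. *)
Definition mxfunc (R : realType) (n : nat) (f : R -> R) (A : 'M[R[i]]_n) :
    'M[R[i]]_n :=
  (spectralmx A) ^t*
    *m diag_mx (map_mx (fun x : R[i] => (f (complex.Re x))%:C) (spectral_diag A))
    *m spectralmx A.

(* powR 0 s = 0 for s != 0, so positive powers vanish on the kernel of A. *)
Definition mxpow (R : realType) (n : nat) (A : 'M[R[i]]_n) (s : R) :
    'M[R[i]]_n :=
  mxfunc (fun x => powR x s) A.

Definition f_alpha_z (R : realType) (n : nat) (alpha z : R)
    (tau sigma : 'M[R[i]]_n) : R[i] :=
  \tr (mxpow (mxpow tau (alpha / (2 * z))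
                *m mxpow sigma ((1 - alpha) / z)
                *m mxpow tau (alpha / (2 * z))) z).

Definition ket (R : realType) (d : nat) (j : 'I_d) : 'cV[R[i]]_d :=
  delta_mx j 0.

Definition ket_f1 (R : realType) (d : nat) : 'cV[R[i]]_d :=
  (1 / Num.sqrt (d%:R : R))%:C *: \sum_(j < d) ket R j.

Definition f1 (R : realType) (d : nat) : 'M[R[i]]_d :=
  ket_f1 R d *m (ket_f1 R d) ^t*.

Definition T_GR (R : realType) (d : nat) (alpha z : R) (rho : 'M[R[i]]_d) :
    R[i] :=
  1 - f_alpha_z alpha z (f1 R d) rho.

(* Main.v *)
Require Import Defs.

Import Order.TTheory GRing.Theory Num.Theory.

Local Open Scope ring_scope.
Local Open Scope complex_scope.
Local Open Scope sesquilinear_scope.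

(** Functional calculus respects intertwiners: if [A X = X B] with [A], [B]
    normal, then [f(A) X = X f(B)], since in eigenbases of [A] and [B] an entry
    of [X] vanishes unless the two eigenvalues it connects coincide.  Taking
    [X = U], each operator in the definition of [f_alpha_z] is conjugated by [U]
    when [rho] is, and the trace does not see this conjugation. *)

Lemma trmxC_mul (C : numClosedFieldType) (m n p : nat)
    (A : 'M[C]_(m, n)) (B : 'M[C]_(n, p)) :
  (A *m B) ^t* = B ^t* *m A ^t*.
Proof. by rewrite trmx_mul map_mxM. Qed.

Lemma hermsymmx_trmxC (C : numClosedFieldType) (n : nat) (A : 'M[C]_n) :
  (A \is hermsymmx) = (A == A ^t*).
Proof. by rewrite is_hermitianmxE expr0 scale1r. Qed.

Lemma hermsymmx_congr (C : numClosedFieldType) (m n : nat) (A : 'M[C]_n)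
    (X : 'M[C]_(m, n)) :
  A \is hermsymmx -> X *m A *m X ^t* \is hermsymmx.
Proof.
rewrite !hermsymmx_trmxC => /eqP hA.
by rewrite !trmxC_mul trmxCK -hA mulmxA.
Qed.

Lemma spectral_decomp (C : numClosedFieldType) (n : nat) (A : 'M[C]_n) :
  A \is normalmx ->
  A = (spectralmx A) ^t* *m diag_mx (spectral_diag A) *m spectralmx A.
Proof.
move=> /orthomx_spectralP {1}->.
by rewrite invmx_unitary ?spectral_unitarymx.
Qed.

Lemma mulmx_trmxC_unitary (C : numClosedFieldType) (n : nat) (U : 'M[C]_n) :
  U \is unitarymx -> U ^t* *m U = 1%:M.
Proof. by rewrite -trmxC_unitary => /unitarymxP; rewrite trmxCK. Qed.

(** Passes between conjugation by [U] and the intertwining form that [mxfunc_intertwine] takes and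
    returns. *)
Lemma unitary_intertwine (C : numClosedFieldType) (n : nat)
    (U A B : 'M[C]_n) :
  U \is unitarymx -> (A = U *m B *m U ^t*) <-> (A *m U = U *m B).
Proof.
move=> hU; split=> [->|h].
  by rewrite -mulmxA mulmx_trmxC_unitary // mulmx1.
by rewrite -h -mulmxA (unitarymxP hU) mulmx1.
Qed.

(** The values of [f] are real, so the diagonal factor equals its own conjugate. *)
Lemma mxfunc_hermsymmx (R : realType) (n : nat) (f : R -> R) (A : 'M[R[i]]_n) :
  mxfunc f A \is hermsymmx.
Proof.
rewrite /mxfunc -{2}[spectralmx A]trmxCK; apply: hermsymmx_congr.
rewrite hermsymmx_trmxC tr_diag_mx map_diag_mx; apply/eqP; congr diag_mx.
by apply/rowP => j; rewrite !mxE; exact: (esym (conjc_real _)).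
Qed.

(** [spectralmx A] and [spectralmx B] are chosen independently, so even for conjugate [A] and [B]
    the eigenbases need not correspond. The intertwining relation is insensitive to that choice. *)
Lemma mxfunc_intertwine (R : realType) (m n : nat) (f : R -> R)
    (A : 'M[R[i]]_m) (B : 'M[R[i]]_n) (X : 'M[R[i]]_(m, n)) :
  A \is normalmx -> B \is normalmx ->
  A *m X = X *m B -> mxfunc f A *m X = X *m mxfunc f B.
Proof.
move=> /spectral_decomp; rewrite /mxfunc.
set P := spectralmx A; set a := spectral_diag A => eA.
move=> /spectral_decomp.
set Q := spectralmx B; set b := spectral_diag B => eB.
have PP : P *m P ^t* = 1%:M by apply/unitarymxP/spectral_unitarymx.
have PP' : P ^t* *m P = 1%:M by apply/mulmx_trmxC_unitary/spectral_unitarymx.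
have QQ : Q *m Q ^t* = 1%:M by apply/unitarymxP/spectral_unitarymx.
have QQ' : Q ^t* *m Q = 1%:M by apply/mulmx_trmxC_unitary/spectral_unitarymx.
(* [Y] is [X] written between the two eigenbases, where [A] and [B] become diagonal. *)
move=> hX; set Y := P *m X *m Q ^t*.
have eX : X = P ^t* *m Y *m Q.
  by rewrite /Y !mulmxA PP' mul1mx -mulmxA QQ' mulmx1.
have hY : diag_mx a *m Y = Y *m diag_mx b.
  have := congr1 (fun M => P *m M *m Q ^t*) hX.
  rewrite eA eB !mulmxA PP mul1mx => ->.
  by rewrite /Y -!mulmxA QQ mulmx1 !mulmxA.
clearbody Y.
have hfY (g : R[i] -> R[i]) :
    diag_mx (map_mx g a) *m Y = Y *m diag_mx (map_mx g b).
  (* Entrywise, [hY] says that [Y i j] times the difference of the [i]-th entry of [a] and the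
     [j]-th of [b] is zero. Where [Y i j] is nonzero the eigenvalues agree, hence so do their images
     under [g]. *)
  apply/matrixP => i j; rewrite mul_diag_mx mul_mx_diag !mxE.
  have := congr1 (fun M : 'M_(m, n) => M i j) hY.
  rewrite mul_diag_mx mul_mx_diag !mxE mulrC.
  have [-> _|nz /(mulfI nz) ->] := eqVneq (Y i j) 0; first by rewrite mulr0 mul0r.
  by rewrite mulrC.
rewrite eX !mulmxA -[_ *m P *m P ^t*]mulmxA PP mulmx1.
rewrite -[_ *m Q *m Q ^t*]mulmxA QQ mulmx1.
by rewrite -[_ *m diag_mx _ *m Y]mulmxA hfY !mulmxA.
Qed.

Lemma f_alpha_z_stabilizer (R : realType) (n : nat) (alpha z : R)
    (U tau sigma : 'M[R[i]]_n) :
  U \is unitarymx -> U *m tau *m U ^t* = tau ->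
  tau \is hermsymmx -> sigma \is hermsymmx ->
  f_alpha_z alpha z tau (U *m sigma *m U ^t*) = f_alpha_z alpha z tau sigma.
Proof.
move=> hU htau tau_herm sigma_herm; rewrite /f_alpha_z.
set s := alpha / (2 * z); set t := (1 - alpha) / z.
set T := mxpow tau s.
have T_adj : T = T ^t* by apply/eqP; rewrite -hermsymmx_trmxC mxfunc_hermsymmx.
(* [htau] says that [U] intertwines [tau] with itself, and the power inherits this. *)
have TU : T *m U = U *m T.
  apply: mxfunc_intertwine; try exact: hermitian_normalmx.
  by apply/unitary_intertwine.
clearbody T.
(* As [T] is self-adjoint, [T *m S *m T] is the congruence [T *m S *m T ^t*]. Its normality is
   needed for the outer power [z]. *)
have sandwich_normal (S : 'M[R[i]]_n) :
    S \is hermsymmx -> T *m S *m T \is normalmx.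
  move=> S_herm; apply: hermitian_normalmx.
  rewrite {2}T_adj; exact: hermsymmx_congr.
have S_U : mxpow (U *m sigma *m U ^t*) t *m U = U *m mxpow sigma t.
  apply: mxfunc_intertwine.
  - exact/hermitian_normalmx/hermsymmx_congr.
  - exact: hermitian_normalmx.
  - by apply/unitary_intertwine.
have S'_herm : mxpow (U *m sigma *m U ^t*) t \is hermsymmx
  by apply: mxfunc_hermsymmx.
have S_herm : mxpow sigma t \is hermsymmx by apply: mxfunc_hermsymmx.
move: (mxpow (U *m _ *m _) t) (mxpow sigma t) => S' S in S_U S'_herm S_herm *.
have -> : mxpow (T *m S' *m T) z = U *m mxpow (T *m S *m T) z *m U ^t*.
  apply/unitary_intertwine => //; apply: mxfunc_intertwine.
  - exact: sandwich_normal.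
  - exact: sandwich_normal.
  (* [U] moves left one factor at a time: past [T], past [S'] (which becomes [S]), past [T]
     again. *)
  - by rewrite -mulmxA TU mulmxA -[T *m S' *m U]mulmxA S_U !mulmxA TU.
by rewrite mxtrace_mulC mulmxA mulmx_trmxC_unitary // mul1mx.
Qed.

Theorem proposition2 (R : realType) (d : nat) (alpha z : R)
  (halpha : 0 < alpha < 1) (hz : Num.max alpha (1 - alpha) <= z)
  (U : 'M[R[i]]_d) (hU : U \is unitarymx)
  (hf1 : U *m f1 R d *m U ^t* = f1 R d)
  (rho : 'M[R[i]]_d) (hrho : density_matrix rho) :
  T_GR alpha z (U *m rho *m U ^t*) = T_GR alpha z rho.
Proof.
have [[rho_herm _] _] := hrho.
have f1_herm : f1 R d \is hermsymmx.
  by rewrite hermsymmx_trmxC /f1 trmxC_mul trmxCK.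
(* Here [tau] is [f1 R d], which [U] fixes by [hf1]. *)
by rewrite /T_GR f_alpha_z_stabilizer.
Qed.
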